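(* Let $\mathsf{C}$ be a category and $F:\mathsf{C}\to\mathsf{C}$ an endofunctor. Let $b:B\to FB$ be an $F$-coalgebra and $a:FA\to A$ an $F$-algebra. (1) Assume that $B$ admits a free algebra $T^F(B)$, with unit $\mathsf{in}:B\to T^F(B)$ and algebra structure $\alpha:FT^F(B)\to T^F(B)$. Let $\mathsf{unfold}:T^F(B)\to T^F(B)$ be the free extension of the composite $$B\xrightarrow{\,b\,}FB\xrightarrow{F\mathsf{in}}FT^F(B)\xrightarrow{\,\alpha\,}T^F(B).$$ Then a relatively initial algebra for $b$ is the same as a coequalizer of $\mathrm{id},\mathsf{unfold}:T^F(B)\rightrightarrows T^F(B)$ in the category of $F$-algebras. Explicitly: $j\mapsto\ulcorner j\urcorner$ and $f\mapsto f\circ\mathsf{in}$ are mutually inverse correspondences between pairs $(d:FD\to D,\ j:B\to D)$ exhibiting $d$ as initial relative to $b$ with universal ca-morphism $j$, and algebra morphisms $f:T^F(B)\to D$ that are coequalizers of $\mathrm{id}$ and $\mathsf{unfold}$ in $\mathsf{Alg}_F$. (2) Assume that $A$ admits a cofree coalgebra $C^F(A)$, with counit $\mathsf{out}:C^F(A)\to A$ and coalgebra structure $\gamma:C^F(A)\to FC^F(A)$. Let $\mathsf{pred}:C^F(A)\to C^F(A)$ be the coextension of the composite $$C^F(A)\xrightarrow{\,\gamma\,}FC^F(A)\xrightarrow{F\mathsf{out}}FA\xrightarrow{\,a\,}A.$$ Then a relatively terminal coalgebra for $a$ is the same as an equalizer of $\mathrm{id},\mathsf{pred}:C^F(A)\rightrightarrows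 C^F(A)$ in the category of $F$-coalgebras. Explicitly: $h\mapsto\llcorner h\lrcorner$ and $g\mapsto\mathsf{out}\circ g$ are mutually inverse correspondences between pairs $(c:D\to FD,\ h:D\to A)$ exhibiting $c$ as terminal relative to $a$ with universal ca-morphism $h$, and coalgebra morphisms $g:D\to C^F(A)$ that are equalizers of $\mathrm{id}$ and $\mathsf{pred}$ in $\mathsf{Coalg}_F$.
   Context: $\mathsf{Alg}_F$ and $\mathsf{Coalg}_F$ denote the categories of $F$-algebras and $F$-coalgebras. For a coalgebra $b:B\to FB$ and an algebra $a:FA\to A$, a ca-morphism from $b$ to $a$ is a morphism $f:B\to A$ with $f=a\circ Ff\circ b$; $\mathsf{CA}_F(b,a)$ is the set of these, functorial in $b$ (contravariantly) and $a$ (covariantly) by composition. An algebra $d:FD\to D$ is initial relative to $b$ if there is a natural isomorphism $\psi:\mathsf{Alg}_F(d,-)\cong\mathsf{CA}_F(b,-)$; its universal ca-morphism is $\psi(\mathrm{id}_D):B\to D$. A coalgebra $c:D\to FD$ is terminal relative to $a$ if there is a natural isomorphism $\phi:\mathsf{Coalg}_F(-,c)\cong\mathsf{CA}_F(-,a)$; its universal ca-morphism is $\phi(\mathrm{id}_D):D\to A$. A free algebra on an object $X$ is an $F$-algebra $\alpha:FT\to T$ with a map $\mathsf{in}:X\to T$ such that for each algebra $FD\to D$ and map $j:X\to D$ there is a unique algebra morphism $\ulcorner j\urcorner:T\to D$ (the extension of $j$) with $j=\ulcorner j\urcorner\circ\mathsf{in}$. A cofree coalgebra on $X$ is an $F$-coalgebra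 $\gamma:C\to FC$ with a map $\mathsf{out}:C\to X$ such that for each coalgebra $D\to FD$ and map $h:D\to X$ there is a unique coalgebra morphism $\llcorner h\lrcorner:D\to C$ (the coextension of $h$) with $h=\mathsf{out}\circ\llcorner h\lrcorner$. *)

(* Defs.v *)
From Stdlib Require Import FunctionalExtensionality ProofIrrelevance ClassicalEpsilon.

Set Implicit Arguments.
Unset Strict Implicit.
Unset Printing Implicit Defensive.

Declare Scope cat_scope.
Delimit Scope cat_scope with cat.
Open Scope cat_scope.

Record Category := {
  Ob :> Type;
  Hom : Ob -> Ob -> Type;
  idm : forall x, Hom x x;
  comp : forall x y z, Hom y z -> Hom x y -> Hom x z;
  comp_idl : forall x y (f : Hom x y), comp (idm y) f = f;
  comp_idr : forall x y (f : Hom x y), comp f (idm x) = f;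
  comp_assoc : forall w x y z (h : Hom y z) (g : Hom x y) (f : Hom w x),
    comp h (comp g f) = comp (comp h g) f
}.

Arguments Hom {c} x y.
Arguments idm {c} x.
Arguments comp {c x y z} g f : rename.

Notation "g ∘ f" := (comp g f) (at level 40, left associativity) : cat_scope.

Record Functor (C D : Category) := {
  fobj :> C -> D;
  fmap : forall x y : C, Hom x y -> Hom (fobj x) (fobj y);
  fmap_id : forall x, fmap (idm x) = idm (fobj x);
  fmap_comp : forall (x y z : C) (g : Hom y z) (f : Hom x y),
    fmap (g ∘ f) = fmap g ∘ fmap f
}.

Arguments fmap {C D} f {x y} h : rename.

Record NatIso (C D : Category) (G H : Functor C D) := {
  nat_fwd :> forall x : C, Hom (G x) (H x);
  nat_bwd : forall x : C, Hom (H x) (G x);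
  nat_comm : forall (x y : C) (f : Hom x y),
    nat_fwd y ∘ fmap G f = fmap H f ∘ nat_fwd x;
  nat_bwdK : forall x, nat_fwd x ∘ nat_bwd x = idm (H x);
  nat_fwdK : forall x, nat_bwd x ∘ nat_fwd x = idm (G x)
}.

Definition op (C : Category) : Category := {|
  Ob := Ob C;
  Hom x y := @Hom C y x;
  idm x := @idm C x;
  comp x y z g f := @comp C z y x f g;
  comp_idl x y f := @comp_idr C y x f;
  comp_idr x y f := @comp_idl C y x f;
  comp_assoc w x y z h g f := eq_sym (@comp_assoc C z y x w f g h)
|}.

(* Plays the role of the category of sets. *)
Definition TypeCat : Category := {|
  Ob := Type;
  Hom A B := A -> B;
  idm A := fun x => x;
  comp A B C g f := fun x => g (f x);
  comp_idl A B f := eq_refl;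
  comp_idr A B f := eq_refl;
  comp_assoc A B C D h g f := eq_refl
|}.

Section HomFunctors.
Variable C : Category.

Program Definition hom_from (x : C) : Functor C TypeCat := {|
  fobj y := Hom x y;
  fmap y z g := fun f : Hom x y => g ∘ f
|}.
Next Obligation.
apply functional_extensionality; intro f; apply comp_idl.
Qed.
Next Obligation.
apply functional_extensionality; intro h; symmetry; apply comp_assoc.
Qed.

Program Definition hom_to (x : C) : Functor (op C) TypeCat := {|
  fobj (y : op C) := @Hom C y x;
  fmap (y z : op C) (g : @Hom C z y) := fun f : @Hom C y x => f ∘ g
|}.
Next Obligation.
apply functional_extensionality; intro f; apply comp_idr.
Qed.
Next Obligation.
apply functional_extensionality; intro h; apply comp_assoc.
Qed.

Definition is_coequalizer (x y z : C) (f g : Hom x y) (q : Hom y z) : Prop :=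
  q ∘ f = q ∘ g /\
  forall (w : C) (h : Hom y w), h ∘ f = h ∘ g -> exists! u : Hom z w, u ∘ q = h.

Definition is_equalizer (x y z : C) (f g : Hom x y) (e : Hom z x) : Prop :=
  f ∘ e = g ∘ e /\
  forall (w : C) (h : Hom w x), f ∘ h = g ∘ h -> exists! u : Hom w z, e ∘ u = h.

End HomFunctors.

Section Algebras.
Variables (C : Category) (F : Functor C C).

Record Algebra := { acar :> Ob C; astr : Hom (F acar) acar }.

Record AlgHom (a a' : Algebra) := {
  alg_mor :> Hom a a';
  alg_comm : alg_mor ∘ astr a = astr a' ∘ fmap F alg_mor
}.

Record Coalgebra := { ccar :> Ob C; cstr : Hom ccar (F ccar) }.

Record CoalgHom (c c' : Coalgebra) := {
  coalg_mor :> Hom c c';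
  coalg_comm : cstr c' ∘ coalg_mor = fmap F coalg_mor ∘ cstr c
}.

Lemma AlgHom_eq (a a' : Algebra) (f g : AlgHom a a') :
  alg_mor f = alg_mor g -> f = g.
Proof.
destruct f as [f Hf], g as [g Hg]; simpl; intros e; subst g.
f_equal; apply proof_irrelevance.
Qed.

Lemma CoalgHom_eq (c c' : Coalgebra) (f g : CoalgHom c c') :
  coalg_mor f = coalg_mor g -> f = g.
Proof.
destruct f as [f Hf], g as [g Hg]; simpl; intros e; subst g.
f_equal; apply proof_irrelevance.
Qed.

Program Definition Alg : Category := {|
  Ob := Algebra;
  Hom := AlgHom;
  idm a := {| alg_mor := idm (acar a) |};
  comp a1 a2 a3 g f := {| alg_mor := alg_mor g ∘ alg_mor f |}
|}.
Next Obligation. now rewrite fmap_id, comp_idl, comp_idr. Qed.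
Next Obligation.
now rewrite fmap_comp, <- comp_assoc, alg_comm, comp_assoc, alg_comm, comp_assoc.
Qed.
Next Obligation. apply AlgHom_eq, comp_idl. Qed.
Next Obligation. apply AlgHom_eq, comp_idr. Qed.
Next Obligation. apply AlgHom_eq, comp_assoc. Qed.

Program Definition Coalg : Category := {|
  Ob := Coalgebra;
  Hom := CoalgHom;
  idm c := {| coalg_mor := idm (ccar c) |};
  comp c1 c2 c3 g f := {| coalg_mor := coalg_mor g ∘ coalg_mor f |}
|}.
Next Obligation. now rewrite fmap_id, comp_idl, comp_idr. Qed.
Next Obligation.
now rewrite fmap_comp, comp_assoc, coalg_comm, <- comp_assoc, coalg_comm, comp_assoc.
Qed.
Next Obligation. apply CoalgHom_eq, comp_idl. Qed.
Next Obligation. apply CoalgHom_eq, comp_idr. Qed.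
Next Obligation. apply CoalgHom_eq, comp_assoc. Qed.

Record CAHom (b : Coalgebra) (a : Algebra) := {
  ca_mor :> Hom b a;
  ca_eq : ca_mor = astr a ∘ fmap F ca_mor ∘ cstr b
}.

Lemma CAHom_eq (b : Coalgebra) (a : Algebra) (f g : CAHom b a) :
  ca_mor f = ca_mor g -> f = g.
Proof.
destruct f as [f Hf], g as [g Hg]; simpl; intros e; subst g.
f_equal; apply proof_irrelevance.
Qed.

Program Definition ca_post (b : Coalgebra) (a a' : Algebra)
    (g : AlgHom a a') (f : CAHom b a) : CAHom b a' :=
  {| ca_mor := alg_mor g ∘ ca_mor f |}.
Next Obligation.
rewrite (ca_eq f) at 1.
now rewrite fmap_comp, !comp_assoc, alg_comm.
Qed.

Program Definition ca_pre (b b' : Coalgebra) (a : Algebra)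
    (g : CoalgHom b' b) (f : CAHom b a) : CAHom b' a :=
  {| ca_mor := ca_mor f ∘ coalg_mor g |}.
Next Obligation.
rewrite (ca_eq f) at 1.
now rewrite fmap_comp, <- !comp_assoc, coalg_comm.
Qed.

Program Definition CA_from (b : Coalgebra) : Functor Alg TypeCat := {|
  fobj (a : Alg) := CAHom b a;
  fmap (a a' : Alg) (g : AlgHom a a') := @ca_post b a a' g
|}.
Next Obligation.
apply functional_extensionality; intro f; apply CAHom_eq, comp_idl.
Qed.
Next Obligation.
apply functional_extensionality; intro h; apply CAHom_eq; symmetry; apply comp_assoc.
Qed.

Program Definition CA_to (a : Algebra) : Functor (op Coalg) TypeCat := {|
  fobj (b : op Coalg) := CAHom b a;
  fmap (b b' : op Coalg) (g : CoalgHom b' b) := @ca_pre b b' a g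
|}.
Next Obligation.
apply functional_extensionality; intro f; apply CAHom_eq, comp_idr.
Qed.
Next Obligation.
apply functional_extensionality; intro h; apply CAHom_eq, comp_assoc.
Qed.

(* The pair [(d, j)] exhibits [d] as initial relative to [b] with universal
   ca-morphism [j], i.e. [j] is the value of some witness [psi] at the identity. *)
Definition relatively_initial (b : Coalgebra) (d : Algebra) (j : Hom b d) : Prop :=
  exists psi : NatIso (@hom_from Alg d) (CA_from b),
    ca_mor (psi d (@idm Alg d)) = j.

Definition relatively_terminal (a : Algebra) (c : Coalgebra) (h : Hom c a) : Prop :=
  exists phi : NatIso (@hom_to Coalg c) (CA_to a),
    ca_mor (phi c (@idm Coalg c)) = h.

Definition is_free_algebra (X : C) (T : Algebra) (inn : Hom X T) : Prop :=
  forall (D : Algebra) (j : Hom X D), exists! f : AlgHom T D, j = alg_mor f ∘ inn.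

Definition is_cofree_coalgebra (X : C) (K : Coalgebra) (out : Hom K X) : Prop :=
  forall (D : Coalgebra) (h : Hom D X), exists! f : CoalgHom D K, h = out ∘ coalg_mor f.

Definition extension (X : C) (T : Algebra) (inn : Hom X T)
    (HT : is_free_algebra inn) (D : Algebra) (j : Hom X D) : AlgHom T D :=
  proj1_sig (constructive_definite_description _ (HT D j)).

Definition coextension (X : C) (K : Coalgebra) (out : Hom K X)
    (HK : is_cofree_coalgebra out) (D : Coalgebra) (h : Hom D X) : CoalgHom D K :=
  proj1_sig (constructive_definite_description _ (HK D h)).

Definition unfold_hom (b : Coalgebra) (T : Algebra) (inn : Hom b T)
    (HT : is_free_algebra inn) : AlgHom T T :=
  extension HT (astr T ∘ fmap F inn ∘ cstr b).

Definition pred_hom (a : Algebra) (K : Coalgebra) (out : Hom K a)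
    (HK : is_cofree_coalgebra out) : CoalgHom K K :=
  coextension HK (astr a ∘ fmap F out ∘ cstr K).

End Algebras.

Arguments relatively_initial {C F} b d j.
Arguments relatively_terminal {C F} a c h.

Definition mutually_inverse (X Y : Type) (P : X -> Prop) (Q : Y -> Prop)
    (u : X -> Y) (v : Y -> X) : Prop :=
  (forall x, P x -> Q (u x)) /\
  (forall y, Q y -> P (v y)) /\
  (forall x, P x -> v (u x) = x) /\
  (forall y, Q y -> u (v y) = y).

(* Main.v *)
(* By the Yoneda lemma, d is initial relative to b with universal ca-morphism j
   iff j is a universal element of CA(b, -): it is a ca-morphism and every
   ca-morphism b -> e factors uniquely through it by an algebra morphism d -> e.
   Precomposition with the unit identifies algebra morphisms T -> e with
   morphisms B -> e, and f coequalizes id and unfold exactly when f ∘ in is a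
   ca-morphism. So the two universal properties coincide.  The second part is dual. *)
From Stdlib Require Import FunctionalExtensionality ClassicalEpsilon.
Require Import Defs.

Section CaMorphisms.
Variables (C : Category) (F : Functor C C).

(** The law of [CAHom] as a predicate, so that it can be asserted of a bare morphism. *)
Definition is_ca (b : Coalgebra F) (a : Algebra F) (f : Hom b a) : Prop :=
  f = astr a ∘ fmap F f ∘ cstr b.

(** Yoneda: [psi] is composition with its value at the identity, and its bijectivity at [e] is
    unique factorization through [j]. *)
Lemma relatively_initialP (b : Coalgebra F) (d : Algebra F) (j : Hom b d) :
  relatively_initial b d j <->
  is_ca b d j /\
  forall (e : Algebra F) (k : Hom b e), is_ca b e k ->
    exists! u : AlgHom d e, alg_mor u ∘ j = k.
Proof.
split.
- intros [psi <-]; split; [apply ca_eq|].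
  assert (yoneda : forall (e : Alg F) (u : AlgHom d e),
    psi e u = ca_post u (psi d (@idm (Alg F) d))).
  { intros e u.
    (* Naturality along [u], evaluated at the identity of [d]. *)
    pose proof (equal_f (@nat_comm _ _ _ _ psi d e u) (@idm (Alg F) d)) as H.
    refine (eq_trans (f_equal (psi e) _) H).
    apply AlgHom_eq; cbn; now rewrite comp_idr. }
  intros e k Hk.
  (* The factorization of [k] is its preimage under [psi]; the two inverse laws give existence and
     uniqueness. *)
  exists (@nat_bwd _ _ _ _ psi e (Build_CAHom Hk)); split.
  + pose proof (equal_f (@nat_bwdK _ _ _ _ psi e) (Build_CAHom Hk)) as H.
    cbn in H; rewrite yoneda in H; exact (f_equal (@ca_mor _ _ _ _) H).
  + intros u Hu.
    assert (Eu : psi e u = Build_CAHom Hk).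
    { rewrite yoneda; apply CAHom_eq; exact Hu. }
    rewrite <- Eu; exact (equal_f (@nat_fwdK _ _ _ _ psi e) u).
- intros [Hj Hu].
  (* Definite description turns unique factorization into a function, the inverse of composition
     with [j]. *)
  pose (factor := fun (e : Algebra F) (k : CAHom b e) =>
    constructive_definite_description _ (Hu e (ca_mor k) (ca_eq k))).
  unshelve eexists (@Build_NatIso (Alg F) TypeCat (@hom_from (Alg F) d) (CA_from b)
    (fun e u => ca_post u (Build_CAHom Hj)) (fun e k => proj1_sig (factor e k)) _ _ _).
  + intros e e' g; apply functional_extensionality; intro u.
    apply CAHom_eq; cbn; symmetry; apply comp_assoc.
  + intros e; apply functional_extensionality; intro k.
    apply CAHom_eq; exact (proj2_sig (factor e k)).
  + intros e; apply functional_extensionality; intro u.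
    set (k := ca_post u (Build_CAHom Hj)).
    destruct (Hu e (ca_mor k) (ca_eq k)) as [v [_ Hv]].
    transitivity v; [symmetry|]; apply Hv; [exact (proj2_sig (factor e k))|reflexivity].
  + cbn; apply comp_idl.
Qed.

(** Yoneda over [op (Coalg F)]: morphisms now act by precomposition, so [phi] is precomposition of
    [h]. *)
Lemma relatively_terminalP (a : Algebra F) (c : Coalgebra F) (h : Hom c a) :
  relatively_terminal a c h <->
  is_ca c a h /\
  forall (e : Coalgebra F) (k : Hom e a), is_ca e a k ->
    exists! u : CoalgHom e c, h ∘ coalg_mor u = k.
Proof.
split.
- intros [phi <-]; split; [apply ca_eq|].
  assert (yoneda : forall (e : Coalg F) (u : CoalgHom e c),
    phi e u = ca_pre u (phi c (@idm (Coalg F) c))).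
  { intros e u.
    pose proof (equal_f (@nat_comm _ _ _ _ phi c e u) (@idm (Coalg F) c)) as H.
    refine (eq_trans (f_equal (phi e) _) H).
    apply CoalgHom_eq; cbn; now rewrite comp_idl. }
  intros e k Hk.
  exists (@nat_bwd _ _ _ _ phi e (Build_CAHom Hk)); split.
  + pose proof (equal_f (@nat_bwdK _ _ _ _ phi e) (Build_CAHom Hk)) as H.
    cbn in H; rewrite yoneda in H; exact (f_equal (@ca_mor _ _ _ _) H).
  + intros u Hu.
    assert (Eu : phi e u = Build_CAHom Hk).
    { rewrite yoneda; apply CAHom_eq; exact Hu. }
    rewrite <- Eu; exact (equal_f (@nat_fwdK _ _ _ _ phi e) u).
- intros [Hh Hu].
  pose (factor := fun (e : Coalgebra F) (k : CAHom e a) =>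
    constructive_definite_description _ (Hu e (ca_mor k) (ca_eq k))).
  unshelve eexists (@Build_NatIso (op (Coalg F)) TypeCat (@hom_to (Coalg F) c) (CA_to a)
    (fun e u => ca_pre u (Build_CAHom Hh)) (fun e k => proj1_sig (factor e k)) _ _ _).
  + intros e e' g; apply functional_extensionality; intro u.
    apply CAHom_eq; cbn; apply comp_assoc.
  + intros e; apply functional_extensionality; intro k.
    apply CAHom_eq; exact (proj2_sig (factor e k)).
  + intros e; apply functional_extensionality; intro u.
    set (k := ca_pre u (Build_CAHom Hh)).
    (* Both [u] and the chosen factorization factor [k], so each equals the unique [v]. *)
    destruct (Hu e (ca_mor k) (ca_eq k)) as [v [_ Hv]].
    transitivity v; [symmetry|]; apply Hv; [exact (proj2_sig (factor e k))|reflexivity].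
  + cbn; apply comp_idr.
Qed.

End CaMorphisms.

Arguments is_ca {C F} b a f.

Section FreeAlgebra.
Variables (C : Category) (F : Functor C C) (b : Coalgebra F) (T : Algebra F).
Variables (inn : Hom b T) (HT : is_free_algebra inn).

Lemma extensionK (D : Algebra F) (j : Hom b D) :
  alg_mor (extension HT j) ∘ inn = j.
Proof.
symmetry; exact (proj2_sig (constructive_definite_description _ (HT D j))).
Qed.

Lemma free_hom_ext (D : Algebra F) (f g : AlgHom T D) :
  alg_mor f ∘ inn = alg_mor g ∘ inn -> f = g.
Proof.
intros E; destruct (HT D (alg_mor f ∘ inn)) as [v [_ Hv]].
transitivity v; [symmetry|]; apply Hv; [reflexivity|exact E].
Qed.

(** Algebra morphisms out of [T] may be compared after restriction along [inn], where the two sides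
    become the two sides of the ca-equation for [f ∘ inn]. *)
Lemma coequalizes_unfoldP (D : Algebra F) (f : AlgHom T D) :
  @comp (Alg F) _ _ _ f (@idm (Alg F) T) = @comp (Alg F) _ _ _ f (unfold_hom HT)
  <-> is_ca b D (alg_mor f ∘ inn).
Proof.
rewrite (@comp_idr (Alg F)); unfold is_ca.
(* By definition [unfold] restricts to [astr T ∘ fmap F inn ∘ cstr b]; since [f] is an algebra
   morphism, it moves past [astr T]. *)
assert (E : alg_mor (@comp (Alg F) _ _ _ f (unfold_hom HT)) ∘ inn =
  astr D ∘ fmap F (alg_mor f ∘ inn) ∘ cstr b).
{ cbn; unfold unfold_hom.
  now rewrite <- comp_assoc, extensionK, fmap_comp, !comp_assoc, alg_comm. }
rewrite <- E; split.
- intros H; exact (f_equal (fun g : AlgHom T D => alg_mor g ∘ inn) H).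
- apply free_hom_ext.
Qed.

Lemma coequalizer_relatively_initial (D : Algebra F) (f : AlgHom T D) :
  @is_coequalizer (Alg F) T T D (@idm (Alg F) T) (unfold_hom HT) f <->
  relatively_initial b D (alg_mor f ∘ inn).
Proof.
rewrite relatively_initialP; unfold is_coequalizer.
rewrite coequalizes_unfoldP.
split; intros [Hf Hu]; (split; [exact Hf|]).
- intros e k Hk.
  (* The coequalizer property is tested on the extension of [k], which restricts to the ca-morphism
     [k]. *)
  destruct (Hu e (extension HT k)) as [u [Eu Uu]].
  { apply coequalizes_unfoldP; now rewrite extensionK. }
  exists u; split.
  + rewrite comp_assoc, <- (extensionK e k), <- Eu; reflexivity.
  + intros v Hv; apply Uu, free_hom_ext; cbn.
    now rewrite extensionK, <- comp_assoc.
- intros e k Hk.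
  destruct (Hu e (alg_mor k ∘ inn)) as [u [Eu Uu]].
  { now apply coequalizes_unfoldP. }
  exists u; split.
  + apply free_hom_ext; cbn; now rewrite <- comp_assoc.
  + intros v Hv; apply Uu; rewrite <- Hv; cbn; apply comp_assoc.
Qed.

End FreeAlgebra.

Section CofreeCoalgebra.
Variables (C : Category) (F : Functor C C) (a : Algebra F) (K : Coalgebra F).
Variables (out : Hom K a) (HK : is_cofree_coalgebra out).

Lemma coextensionK (D : Coalgebra F) (h : Hom D a) :
  out ∘ coalg_mor (coextension HK h) = h.
Proof.
symmetry; exact (proj2_sig (constructive_definite_description _ (HK D h))).
Qed.

Lemma cofree_hom_ext (D : Coalgebra F) (f g : CoalgHom D K) :
  out ∘ coalg_mor f = out ∘ coalg_mor g -> f = g.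
Proof.
intros E; destruct (HK D (out ∘ coalg_mor f)) as [v [_ Hv]].
transitivity v; [symmetry|]; apply Hv; [reflexivity|exact E].
Qed.

(** Morphisms into [K] are compared after [out]; there [pred] becomes
    [astr a ∘ fmap F out ∘ cstr K], and [g] moves past [cstr K]. *)
Lemma equalizes_predP (D : Coalgebra F) (g : CoalgHom D K) :
  @comp (Coalg F) _ _ _ (@idm (Coalg F) K) g = @comp (Coalg F) _ _ _ (pred_hom HK) g
  <-> is_ca D a (out ∘ coalg_mor g).
Proof.
rewrite (@comp_idl (Coalg F)); unfold is_ca.
assert (E : out ∘ coalg_mor (@comp (Coalg F) _ _ _ (pred_hom HK) g) =
  astr a ∘ fmap F (out ∘ coalg_mor g) ∘ cstr D).
{ cbn; unfold pred_hom.
  now rewrite comp_assoc, coextensionK, fmap_comp, <- !comp_assoc, coalg_comm. }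
rewrite <- E; split.
- intros H; exact (f_equal (fun g : CoalgHom D K => out ∘ coalg_mor g) H).
- apply cofree_hom_ext.
Qed.

Lemma equalizer_relatively_terminal (D : Coalgebra F) (g : CoalgHom D K) :
  @is_equalizer (Coalg F) K K D (@idm (Coalg F) K) (pred_hom HK) g <->
  relatively_terminal a D (out ∘ coalg_mor g).
Proof.
rewrite relatively_terminalP; unfold is_equalizer.
rewrite equalizes_predP.
split; intros [Hg Hu]; (split; [exact Hg|]).
- intros e k Hk.
  (* The coextension of [k] equalizes because composing it with [out] returns the ca-morphism
     [k]. *)
  destruct (Hu e (coextension HK k)) as [u [Eu Uu]].
  { apply equalizes_predP; now rewrite coextensionK. }
  exists u; split.
  + rewrite <- comp_assoc, <- (coextensionK e k), <- Eu; reflexivity.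
  + intros v Hv; apply Uu, cofree_hom_ext; cbn.
    now rewrite coextensionK, comp_assoc.
- intros e k Hk.
  destruct (Hu e (out ∘ coalg_mor k)) as [u [Eu Uu]].
  { now apply equalizes_predP. }
  exists u; split.
  + apply cofree_hom_ext; cbn; now rewrite comp_assoc.
  + intros v Hv; apply Uu; rewrite <- Hv; cbn; symmetry; apply comp_assoc.
Qed.

End CofreeCoalgebra.

Theorem theorem3p4 (C : Category) (F : Functor C C)
    (b : Coalgebra F) (a : Algebra F) :
  (forall (T : Algebra F) (inn : Hom b T) (HT : is_free_algebra inn)
      (d : Algebra F),
    mutually_inverse
      (fun j : Hom b d => relatively_initial b d j)
      (fun f : AlgHom T d =>
         @is_coequalizer (Alg F) T T d (@idm (Alg F) T) (unfold_hom HT) f)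
      (fun j => extension HT j)
      (fun f => comp (alg_mor f) inn))
  /\
  (forall (K : Coalgebra F) (out : Hom K a) (HK : is_cofree_coalgebra out)
      (c : Coalgebra F),
    mutually_inverse
      (fun h : Hom c a => relatively_terminal a c h)
      (fun g : CoalgHom c K =>
         @is_equalizer (Coalg F) K K c (@idm (Coalg F) K) (pred_hom HK) g)
      (fun h => coextension HK h)
      (fun g => comp out (coalg_mor g))).
Proof.
split.
- intros T inn HT d; split; [|split; [|split]].
  + intros j Hj; apply coequalizer_relatively_initial; now rewrite extensionK.
  + intros f; apply coequalizer_relatively_initial.
  + intros j _; apply extensionK.
  (* [f] and the extension of [f ∘ inn] have the same restriction along [inn]. *)
  + intros f _; apply (free_hom_ext _ _ _ _ _ HT), extensionK.
- intros K out HK c; split; [|split; [|split]].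
  + intros h Hh; apply equalizer_relatively_terminal; now rewrite coextensionK.
  + intros g; apply equalizer_relatively_terminal.
  + intros h _; apply coextensionK.
  + intros g _; apply (cofree_hom_ext _ _ _ _ _ HK), coextensionK.
Qed.
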